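(* Let $p_{0}=\dfrac{4\log 2}{4+2\log 2-\pi}=1.2351\cdots$ and let $p\in\mathbb{R}$. Then the inequality $$B(a,b)>M_{p}(a,b)$$ holds for all $a,b>0$ with $a\neq b$ if and only if $p\leq p_{0}$.
   Context: For $a,b>0$ with $a\neq b$ and $r\in\mathbb{R}$, the $r$th power mean is $M_{r}(a,b)=\left(\frac{a^{r}+b^{r}}{2}\right)^{1/r}$ for $r\neq 0$ and $M_{0}(a,b)=\sqrt{ab}$. Let $A(a,b)=\frac{a+b}{2}$ (arithmetic mean), $Q(a,b)=\sqrt{\frac{a^{2}+b^{2}}{2}}$ (quadratic mean), $T(a,b)=\frac{a-b}{2\arctan\left(\frac{a-b}{a+b}\right)}$ (second Seiffert mean), and $B(a,b)=Q(a,b)e^{A(a,b)/T(a,b)-1}$ (Sándor-Yang mean). Here $\log$ is the natural logarithm. *)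

(* Defs.v *)
(* Stdlib's classical real numbers. *)
From Stdlib Require Import Reals.
Open Scope R_scope.

(* [Rpower x y] is [exp (y * ln x)], the usual real power for [0 < x]; the
   means below are only meaningful for [0 < a] and [0 < b]. *)
Definition power_mean (r a b : R) : R :=
  if Req_dec_T r 0 then sqrt (a * b)
  else Rpower ((Rpower a r + Rpower b r) / 2) (1 / r).

Definition arithmetic_mean (a b : R) : R := (a + b) / 2.

Definition quadratic_mean (a b : R) : R := sqrt ((a ^ 2 + b ^ 2) / 2).

(* Meaningful for [a <> b] only. *)
Definition seiffert_mean2 (a b : R) : R :=
  (a - b) / (2 * atan ((a - b) / (a + b))).

Definition sandor_yang_mean (a b : R) : R :=
  quadratic_mean a b * exp (arithmetic_mean a b / seiffert_mean2 a b - 1).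

Definition p0 : R := 4 * ln 2 / (4 + 2 * ln 2 - PI).

(* Main.v *)
Require Import Defs.
From Stdlib Require Import Reals Lra.
From Coquelicot Require Import Coquelicot.
Open Scope R_scope.

(** Both means are symmetric and homogeneous, so one may take
    [a = k (cos x + sin x)] and [b = k (cos x - sin x)] with [0 < x < PI / 4],
    that is [tan x = (a - b) / (a + b)].  In these polar coordinates the
    quadratic mean is [k] and the Sandor-Yang mean is
    [k exp (x cos x / sin x - 1)] ([sandor_yang_mean_polar]), so everything is
    governed by the sign of
    [log_quotient p x
     = x cos x / sin x - 1
       - ln (((cos x + sin x)^p + (cos x - sin x)^p) / 2) / p].

    For [p > 0] this function tends to [0] at [0], and at [PI / 4], where [b]
    vanishes, it tends to [PI / 4 - 1 - ln 2 / 2 + ln 2 / p].  The last number is zero for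
    [p = p0] and negative for [p > p0], which proves that [p <= p0] is
    necessary ([log_quotient_pos_le_p0]).  Conversely power means increase with
    the exponent ([power_mean_monotone]), so only [p = p0] has to be
    treated.  There the function tends to [0] at both ends of the interval, and it
    is positive in between as soon as its derivative changes sign at most once,
    from positive to negative ([positive_between_zeros]).

    Let [stays_negative] be the property of a function that, once [<= 0], it is
    [< 0] forever.  A function starting from [0] has it when its derivative
    has it, and it is insensitive to positive factors.  This gives a descent,
    with [q = p0 - 1 > 0]:
    - the derivative of [log_quotient p0] has the sign of [log_ratio q], a
      difference of logarithms starting from [0], so that differentiating it
      removes all real powers;
    - the derivative of [log_ratio q] at [x] has the sign, at [2 x], of a
      function made of [x], [sin x], [cos x] and starting from [0]
      ([stays_negative_comparison]);
    - the derivative of that one is a positive factor times [1 / q - E], where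
      [E] is a product of three elementary increasing functions
      ([stays_negative_comparison_derivative]). *)

(** * Functions that change sign at most once *)

(** Tracks a single change of sign, from positive to negative, without having to
    name the place where it happens or to know that it happens at all. *)
Definition stays_negative (b : R) (f : R -> R) : Prop :=
  forall x y, 0 < x < y -> y < b -> f x <= 0 -> f y < 0.

Lemma mean_value (f df : R -> R) (x y : R) :
  x < y -> (forall z, x <= z <= y -> is_derive f z (df z)) ->
  exists z, x < z < y /\ f y - f x = df z * (y - x).
Proof.
  intros Hxy Hd.
  destruct (MVT_cor2 f df x y Hxy) as [z [E Hz]].
  - intros c Hc. apply is_derive_Reals. now apply Hd.
  - exists z. split; [exact Hz | exact E].
Qed.

Lemma derive_pos_increasing (f df : R -> R) (x y : R) :
  x < y -> (forall z, x <= z <= y -> is_derive f z (df z)) ->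
  (forall z, x < z < y -> 0 < df z) -> f x < f y.
Proof.
  intros Hxy Hd Hp. destruct (mean_value f df x y Hxy Hd) as [z [Hz E]].
  pose proof (Rmult_lt_0_compat _ (y - x) (Hp z Hz)). lra.
Qed.

Lemma derive_neg_decreasing (f df : R -> R) (x y : R) :
  x < y -> (forall z, x <= z <= y -> is_derive f z (df z)) ->
  (forall z, x < z < y -> df z < 0) -> f y < f x.
Proof.
  intros Hxy Hd Hn. destruct (mean_value f df x y Hxy Hd) as [z [Hz E]].
  pose proof (Hn z Hz). nra.
Qed.

Lemma continuous_le_from_right (g : R -> R) (a b m : R) :
  a < b -> continuity_pt g a -> (forall z, a < z < b -> g z <= m) -> g a <= m.
Proof.
  intros Hab Hc Hm. apply Rnot_lt_le. intros Hlt.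
  destruct (Hc (g a - m) ltac:(lra)) as [d [Hd Hz]].
  set (z := a + Rmin d (b - a) / 2).
  assert (Hmin : 0 < Rmin d (b - a)) by (apply Rmin_glb_lt; lra).
  pose proof (Rmin_l d (b - a)). pose proof (Rmin_r d (b - a)).
  assert (Hza : a < z < b) by (unfold z; lra).
  specialize (Hm z Hza).
  assert (Hg : R_dist (g z) (g a) < g a - m).
  { apply Hz. split.
    - split; [exact I | lra].
    - simpl. unfold R_dist. rewrite Rabs_right; unfold z; lra. }
  unfold R_dist in Hg. apply Rabs_def2 in Hg. lra.
Qed.

Lemma continuous_le_from_left (g : R -> R) (a b m : R) :
  a < b -> continuity_pt g b -> (forall z, a < z < b -> g z <= m) -> g b <= m.
Proof.
  intros Hab Hc Hm.
  assert (H : g (- - b) <= m).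
  { apply (continuous_le_from_right (fun x => g (- x)) (- b) (- a)); [lra | |].
    - apply (continuity_pt_comp Ropp g).
      + apply continuity_pt_opp, continuity_pt_id.
      + rewrite Ropp_involutive. exact Hc.
    - intros z Hz. apply Hm. lra. }
  now rewrite Ropp_involutive in H.
Qed.

Lemma derivable_continuity_pt (g : R -> R) (x : R) :
  ex_derive g x -> continuity_pt g x.
Proof.
  intros H. apply continuity_pt_filterlim. now apply (ex_derive_continuous g).
Qed.

(** The minorant [g] expresses that [f] has a nonnegative lower limit at [0], where
    [f] itself may be a quotient of vanishing quantities.  If [df] were positive
    up to [x], then [f] would increase from that limit and [f x] would be
    positive; so [df] is negative beyond [x]. *)
Lemma decreasing_once_nonpositive (f df g : R -> R) (b : R) :
  (forall x, 0 < x < b -> is_derive f x (df x)) ->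
  continuity_pt g 0 -> 0 <= g 0 -> (forall x, 0 < x < b -> g x <= f x) ->
  stays_negative b df ->
  forall x y, 0 < x < y -> y < b -> f x <= 0 -> f y < f x.
Proof.
  intros Hd Hc Hg0 Hg Hdf x y Hxy Hyb Hfx.
  apply (derive_neg_decreasing f df); [lra | intros z Hz; apply Hd; lra |].
  (* A nonnegative derivative at some [z > x] forces positivity before [z]. *)
  intros z Hz. apply Rnot_le_lt. intros Hdz.
  assert (Hpos : forall c, 0 < c < z -> 0 < df c).
  { intros c Hcz. apply Rnot_le_lt. intros Hn.
    pose proof (Hdf c z Hcz ltac:(lra) Hn). lra. }
  assert (Hinc : forall u v, 0 < u < v -> v <= x -> f u < f v).
  { intros u v Huv Hv. apply (derive_pos_increasing f df); [lra | |].
    - intros c Hcc. apply Hd. lra.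
    - intros c Hcc. apply Hpos. lra. }
  assert (g 0 <= f (x / 2)).
  { apply (continuous_le_from_right g 0 (x / 2)); [lra | exact Hc |].
    intros u Hu. pose proof (Hg u ltac:(lra)).
    pose proof (Hinc u (x / 2) ltac:(lra) ltac:(lra)). lra. }
  pose proof (Hinc (x / 2) x ltac:(lra) ltac:(lra)). lra.
Qed.

Lemma stays_negative_of_derivative (f df g : R -> R) (b : R) :
  (forall x, 0 < x < b -> is_derive f x (df x)) ->
  continuity_pt g 0 -> 0 <= g 0 -> (forall x, 0 < x < b -> g x <= f x) ->
  stays_negative b df -> stays_negative b f.
Proof.
  intros Hd Hc Hg0 Hg Hdf x y Hxy Hyb Hfx.
  pose proof (decreasing_once_nonpositive f df g b Hd Hc Hg0 Hg Hdf x y Hxy Hyb Hfx).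
  lra.
Qed.

(** A function that rises and then possibly falls, with nonnegative lower limits at
    both ends, is positive: after a nonpositive value it would keep decreasing
    strictly, contradicting the limit at [b].  The minorants [g] and [h]
    stand for these limits. *)
Lemma positive_between_zeros (f df g h : R -> R) (b : R) :
  (forall x, 0 < x < b -> is_derive f x (df x)) ->
  continuity_pt g 0 -> 0 <= g 0 -> (forall x, 0 < x < b -> g x <= f x) ->
  continuity_pt h b -> 0 <= h b -> (forall x, 0 < x < b -> h x <= f x) ->
  stays_negative b df ->
  forall x, 0 < x < b -> 0 < f x.
Proof.
  intros Hd Hgc Hg0 Hg Hhc Hhb Hh Hdf x Hx. apply Rnot_le_lt. intros Hfx.
  pose proof (decreasing_once_nonpositive f df g b Hd Hgc Hg0 Hg Hdf) as Hdec.
  (* A second point [y] makes the bound on the limit at [b] strict. *)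
  set (y := (x + b) / 2).
  pose proof (Hdec x y ltac:(unfold y; lra) ltac:(unfold y; lra) Hfx) as Hfy.
  assert (h b <= f y).
  { apply (continuous_le_from_left h y b); [unfold y; lra | exact Hhc |].
    intros z Hz. assert (0 < z < b) by (unfold y in Hz; lra).
    pose proof (Hh z ltac:(lra)).
    pose proof (Hdec y z ltac:(unfold y in *; lra) ltac:(lra) ltac:(lra)). lra. }
  lra.
Qed.

(** * Trigonometric inequalities *)

Lemma positive_of_derivative (f df : R -> R) (b : R) :
  f 0 = 0 -> (forall x, 0 <= x < b -> is_derive f x (df x)) ->
  (forall x, 0 < x < b -> 0 < df x) -> forall x, 0 < x < b -> 0 < f x.
Proof.
  intros H0 Hd Hp x Hx. rewrite <- H0.
  apply (derive_pos_increasing f df); [lra | |].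
  - intros z Hz. apply Hd. lra.
  - intros z Hz. apply Hp. lra.
Qed.

Lemma trig_first_quadrant (x : R) :
  0 < x < PI / 2 -> 0 < sin x < x /\ 0 < cos x < 1.
Proof.
  intros Hx. pose proof PI_RGT_0.
  repeat split.
  - apply sin_gt_0; lra.
  - apply sin_lt_x; lra.
  - apply cos_gt_0; lra.
  - rewrite <- cos_0. apply cos_decreasing_1; lra.
Qed.

Lemma sin2_cos2_pow (x : R) : sin x ^ 2 = 1 - cos x ^ 2.
Proof. pose proof (sin2_cos2 x) as H. unfold Rsqr in H. lra. Qed.

Lemma x_cos_lt_sin (x : R) : 0 < x < PI / 2 -> x * cos x < sin x.
Proof.
  intros Hx. apply Rlt_0_minus.
  apply (positive_of_derivative (fun x => sin x - x * cos x)
           (fun x => x * sin x) (PI / 2)); [| | | exact Hx].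
  - rewrite sin_0. ring.
  - intros y _. auto_derive; [exact I | ring].
  - intros y Hy. pose proof (trig_first_quadrant y Hy). nra.
Qed.

Lemma one_minus_cos_lt_x_sin (x : R) : 0 < x < PI / 2 -> 0 < x * sin x - 1 + cos x.
Proof.
  apply (positive_of_derivative (fun x => x * sin x - 1 + cos x)
           (fun x => x * cos x) (PI / 2)).
  - rewrite sin_0, cos_0. ring.
  - intros y _. auto_derive; [exact I | ring].
  - intros y Hy. pose proof (trig_first_quadrant y Hy). nra.
Qed.

Lemma cusa_inequality (x : R) : 0 < x < PI / 2 -> 3 * sin x < x * (2 + cos x).
Proof.
  intros Hx. apply Rlt_0_minus.
  apply (positive_of_derivative (fun x => x * (2 + cos x) - 3 * sin x)
           (fun x => 2 - 2 * cos x - x * sin x) (PI / 2)); [| | | exact Hx].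
  - rewrite sin_0. ring.
  - intros y _. auto_derive; [exact I | ring].
  - apply (positive_of_derivative _ (fun x => sin x - x * cos x)).
    + rewrite sin_0, cos_0. ring.
    + intros y _. auto_derive; [exact I | ring].
    + intros y Hy. pose proof (x_cos_lt_sin y Hy). lra.
Qed.

Lemma cube_over_x_minus_sin_increasing (x y : R) :
  0 < x < y -> y < PI / 2 -> x ^ 3 / (x - sin x) < y ^ 3 / (y - sin y).
Proof.
  intros Hxy Hy.
  apply (derive_pos_increasing (fun z => z ^ 3 / (z - sin z))
    (fun z => z ^ 2 * (3 * (z - sin z) - z * (1 - cos z)) / (z - sin z) ^ 2));
    [lra | |].
  - intros z Hz. pose proof (trig_first_quadrant z ltac:(lra)).
    auto_derive; [lra | field; lra].
  - intros z Hz. pose proof (trig_first_quadrant z ltac:(lra)).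
    pose proof (cusa_inequality z ltac:(lra)).
    apply Rdiv_lt_0_compat; [apply Rmult_lt_0_compat|]; nra.
Qed.

Lemma tan_over_x_increasing (x y : R) :
  0 < x < y -> y < PI / 2 -> sin x / (x * cos x) < sin y / (y * cos y).
Proof.
  intros Hxy Hy.
  apply (derive_pos_increasing (fun z => sin z / (z * cos z))
    (fun z => (z - sin z * cos z) / (z * cos z) ^ 2)); [lra | |].
  - intros z Hz. pose proof (trig_first_quadrant z ltac:(lra)).
    auto_derive;
      [repeat apply Rmult_integral_contrapositive_currified; lra |].
    pose proof (sin2_cos2_pow z) as Hs.
    field [Hs]. lra.
  - intros z Hz. pose proof (trig_first_quadrant z ltac:(lra)).
    apply Rdiv_lt_0_compat; [nra |]. apply pow_lt. nra.
Qed.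

(** The function is [(x tan x + 1 - 1 / cos x) / x^2].  The numerator of its
    derivative, [x^2 - x sin x (1 + cos x) + 2 cos x (1 - cos x)], becomes
    [cos x (1 - cos x)^2] when the explicit [x] is replaced by [sin x], and
    expanding in powers of [x - sin x > 0] adds positive terms only. *)
Lemma x_tan_minus_sec_over_square_increasing (x y : R) :
  0 < x < y -> y < PI / 2 ->
  (x * sin x - 1 + cos x) / (x ^ 2 * cos x) <
  (y * sin y - 1 + cos y) / (y ^ 2 * cos y).
Proof.
  intros Hxy Hy.
  apply (derive_pos_increasing (fun z => (z * sin z - 1 + cos z) / (z ^ 2 * cos z))
    (fun z => (z ^ 2 - z * sin z * (1 + cos z) + 2 * cos z * (1 - cos z))
              / (z ^ 3 * cos z ^ 2))); [lra | |].
  - intros z Hz. pose proof (trig_first_quadrant z ltac:(lra)).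
    auto_derive;
      [repeat apply Rmult_integral_contrapositive_currified; lra |].
    pose proof (sin2_cos2_pow z) as Hs.
    field [Hs]. lra.
  - intros z Hz. pose proof (trig_first_quadrant z ltac:(lra)) as [Hs Hc].
    apply Rdiv_lt_0_compat.
    + replace (z ^ 2 - z * sin z * (1 + cos z) + 2 * cos z * (1 - cos z))
        with ((z - sin z) ^ 2 + (z - sin z) * sin z * (1 - cos z)
              + (sin z ^ 2 * (- cos z) + 2 * cos z * (1 - cos z))) by ring.
      rewrite (sin2_cos2_pow z).
      assert (0 < (z - sin z) ^ 2) by (apply pow_lt; lra).
      assert (0 < (z - sin z) * sin z * (1 - cos z))
        by (repeat apply Rmult_lt_0_compat; lra).
      assert (0 < cos z * (1 - cos z) ^ 2)
        by (apply Rmult_lt_0_compat; [|apply pow_lt]; lra).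
      nra.
    + apply Rmult_lt_0_compat; apply pow_lt; lra.
Qed.

(** * The descent to elementary functions *)

(** The function is [2 (x - sin x) (1 / q - E x)], where [E] is the product of
    [x^3 / (x - sin x)], [tan x / x] and [(x tan x + 1 - 1 / cos x) / x^2].  Each
    factor is positive and increasing, hence [1 / q - E] decreases. *)
Lemma stays_negative_comparison_derivative (q : R) :
  0 < q ->
  stays_negative (PI / 2)
    (fun x => 2 * ((x - sin x) / q - sin x * (x * sin x - 1 + cos x) / cos x ^ 2)).
Proof.
  intros Hq.
  set (E := fun x => x ^ 3 / (x - sin x) * (sin x / (x * cos x))
                     * ((x * sin x - 1 + cos x) / (x ^ 2 * cos x))).
  assert (HE : forall x, 0 < x < PI / 2 ->
    2 * ((x - sin x) / q - sin x * (x * sin x - 1 + cos x) / cos x ^ 2)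
    = 2 * (x - sin x) * (1 / q - E x)).
  { intros x Hx. pose proof (trig_first_quadrant x Hx). unfold E. field. lra. }
  intros x y Hxy Hy.
  rewrite (HE x), (HE y) by lra. intros Hle.
  pose proof (trig_first_quadrant x ltac:(lra)) as [Hsx Hcx].
  pose proof (trig_first_quadrant y ltac:(lra)) as [Hsy Hcy].
  assert (HEx : E x < E y).
  { pose proof (one_minus_cos_lt_x_sin x ltac:(lra)).
    assert (0 < x ^ 3) by (apply pow_lt; lra).
    assert (0 < x ^ 2) by (apply pow_lt; lra).
    assert (0 < x ^ 3 / (x - sin x)) by (apply Rdiv_lt_0_compat; lra).
    assert (0 < sin x / (x * cos x)) by (apply Rdiv_lt_0_compat; nra).
    assert (0 < (x * sin x - 1 + cos x) / (x ^ 2 * cos x))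
      by (apply Rdiv_lt_0_compat; nra).
    unfold E.
    apply Rmult_gt_0_lt_compat; [lra | | | now apply x_tan_minus_sec_over_square_increasing].
    - apply Rmult_lt_0_compat.
      + pose proof (cube_over_x_minus_sin_increasing x y Hxy Hy). lra.
      + pose proof (tan_over_x_increasing x y Hxy Hy). lra.
    - apply Rmult_gt_0_lt_compat; [lra | | |].
      + pose proof (cube_over_x_minus_sin_increasing x y Hxy Hy). lra.
      + now apply cube_over_x_minus_sin_increasing.
      + now apply tan_over_x_increasing. }
  assert (1 / q - E x <= 0) by nra.
  nra.
Qed.

(** The function vanishes at [0], and its derivative is the function of the
    preceding lemma.  The division by [cos x] is what makes this derivative
    simple. *)
Lemma stays_negative_comparison (q : R) :
  0 < q ->
  stays_negative (PI / 2)
    (fun x => (x ^ 2 - 2 + 2 * cos x) / q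
              - (2 * x * sin x - 2 + 2 * cos x - x ^ 2 * cos x) / cos x).
Proof.
  intros Hq. eapply stays_negative_of_derivative;
    [| | | intros x _; apply Rle_refl | now apply (stays_negative_comparison_derivative q)].
  - intros x Hx. cbv beta. pose proof (trig_first_quadrant x Hx).
    auto_derive; [lra |]. pose proof (sin2_cos2_pow x) as Hs.
    field [Hs]. lra.
  - apply derivable_continuity_pt. auto_derive. rewrite cos_0. lra.
  - cbv beta. rewrite cos_0. right. field. lra.
Qed.

Lemma trig_first_octant (x : R) :
  0 < x < PI / 4 -> 0 < sin x < cos x /\ cos x < 1 /\ 1 < cos x + sin x.
Proof.
  intros Hx. pose proof (trig_first_quadrant x ltac:(lra)) as [Hs Hc].
  pose proof (cos_gt_0 (2 * x) ltac:(lra) ltac:(lra)) as H2.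
  rewrite cos_2a in H2. pose proof (sin2_cos2_pow x). nra.
Qed.

(** The two quantities whose logarithms occur in [log_ratio]; that the second is
    larger bounds [log_ratio] from below near [0], where both vanish. *)
Lemma log_arguments_pos (x : R) :
  0 < x < PI / 4 ->
  0 < x * (cos x + sin x) - sin x < sin x - x * (cos x - sin x).
Proof.
  intros Hx. pose proof (trig_first_octant x Hx).
  pose proof (trig_first_quadrant x ltac:(lra)).
  pose proof (x_cos_lt_sin x ltac:(lra)). nra.
Qed.

(** Logarithm of the ratio of the two terms whose difference is the numerator of
    the derivative of [log_quotient p], for [q = p - 1]. *)
Definition log_ratio (q x : R) : R :=
  q * (ln (cos x - sin x) - ln (cos x + sin x))
  + (ln (sin x - x * (cos x - sin x)) - ln (x * (cos x + sin x) - sin x)).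

(** The derivative is rational in [x], [sin x] and [cos x].  In the variable
    [2 x] it is a positive multiple of the function of
    [stays_negative_comparison]. *)
Lemma stays_negative_log_ratio (q : R) :
  0 < q -> stays_negative (PI / 4) (log_ratio q).
Proof.
  intros Hq.
  set (W := fun x => 2 * (sin x - x * (cos x - sin x)) * (x * (cos x + sin x) - sin x)).
  set (P := fun x => (x ^ 2 - 2 + 2 * cos x) / q
              - (2 * x * sin x - 2 + 2 * cos x - x ^ 2 * cos x) / cos x).
  assert (HW : forall x, 0 < x < PI / 4 -> 0 < q / W x).
  { intros x Hx. pose proof (log_arguments_pos x Hx). unfold W.
    apply Rdiv_lt_0_compat; nra. }
  apply (stays_negative_of_derivative _ (fun x => q / W x * P (2 * x))
    (fun x => q * (ln (cos x - sin x) - ln (cos x + sin x)))).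
  - intros x Hx. pose proof (trig_first_octant x Hx).
    pose proof (log_arguments_pos x Hx).
    unfold log_ratio, P, W. auto_derive; [repeat split; lra |].
    rewrite cos_2a, sin_2a. pose proof (sin2_cos2_pow x) as Hs.
    field [Hs]. repeat split; try lra. nra.
  - apply derivable_continuity_pt. auto_derive. rewrite cos_0, sin_0. lra.
  - cbv beta. rewrite cos_0, sin_0, Rminus_0_r, Rplus_0_r. lra.
  - intros x Hx. pose proof (log_arguments_pos x Hx) as [HV HU].
    pose proof (ln_increasing _ _ HV HU). unfold log_ratio. lra.
  - intros x y Hxy Hy HP.
    pose proof (HW x ltac:(lra)). pose proof (HW y ltac:(lra)).
    assert (P (2 * x) <= 0) by nra.
    assert (P (2 * y) < 0)
      by (apply (stays_negative_comparison q Hq (2 * x)); [lra | lra | assumption]).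
    nra.
Qed.

(** * The logarithm of the quotient of the two means *)

(** Logarithm of the quotient of the Sandor-Yang mean and the power mean of
    [cos x + sin x] and [cos x - sin x], provided [p <> 0]. *)
Definition log_quotient (p x : R) : R :=
  x * cos x / sin x - 1
  - ln ((Rpower (cos x + sin x) p + Rpower (cos x - sin x) p) / 2) / p.

Lemma Rpower_pos (x y : R) : 0 < Rpower x y.
Proof. apply exp_pos. Qed.

Lemma exp_nondecreasing (x y : R) : x <= y -> exp x <= exp y.
Proof.
  intros [H | ->]; [left; now apply exp_increasing | apply Rle_refl].
Qed.

Lemma Rpower_split (x p : R) : 0 < x -> exp (p * ln x) = x * exp ((p - 1) * ln x).
Proof.
  intros Hx. rewrite <- (exp_ln x Hx) at 2. rewrite <- exp_plus. f_equal. ring.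
Qed.

Definition log_quotient_derivative (p x : R) : R :=
  (Rpower (cos x - sin x) (p - 1) * (sin x - x * (cos x - sin x))
   - Rpower (cos x + sin x) (p - 1) * (x * (cos x + sin x) - sin x))
  / (sin x ^ 2 * (Rpower (cos x + sin x) p + Rpower (cos x - sin x) p)).

Lemma is_derive_log_quotient (p x : R) :
  p <> 0 -> 0 < x < PI / 4 ->
  is_derive (log_quotient p) x (log_quotient_derivative p x).
Proof.
  intros Hp Hx. pose proof (trig_first_octant x Hx).
  unfold log_quotient, log_quotient_derivative, Rpower.
  pose proof (exp_pos (p * ln (cos x + sin x))).
  pose proof (exp_pos (p * ln (cos x - sin x))).
  auto_derive; change (cos x + - sin x) with (cos x - sin x);
    [repeat split; lra |].
  rewrite (Rpower_split (cos x + sin x) p), (Rpower_split (cos x - sin x) p) in * by lra.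
  set (X := exp ((p - 1) * ln (cos x + sin x))) in *.
  set (Y := exp ((p - 1) * ln (cos x - sin x))) in *.
  pose proof (sin2_cos2_pow x) as Hs.
  field [Hs]. repeat split; lra.
Qed.

(** The numerator is a difference [X - Y] of positive quantities, and [log_ratio]
    is [ln (X / Y)]. *)
Lemma log_quotient_derivative_sign (p x : R) :
  0 < x < PI / 4 ->
  (log_quotient_derivative p x <= 0 <-> log_ratio (p - 1) x <= 0) /\
  (log_quotient_derivative p x < 0 <-> log_ratio (p - 1) x < 0).
Proof.
  intros Hx. pose proof (trig_first_octant x Hx).
  pose proof (log_arguments_pos x Hx) as [HV HU].
  unfold log_quotient_derivative.
  set (A := cos x + sin x). set (B := cos x - sin x).
  set (V := x * A - sin x). set (U := sin x - x * B).
  assert (HVA : 0 < V) by exact HV.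
  assert (HUB : 0 < U) by (unfold U, B; lra).
  assert (HE : Rpower B (p - 1) * U - Rpower A (p - 1) * V
     = Rpower A (p - 1) * V * (exp (log_ratio (p - 1) x) - 1)).
  { unfold log_ratio. fold A B. fold U V.
    unfold Rpower.
    replace ((p - 1) * (ln B - ln A) + (ln U - ln V))
      with ((p - 1) * ln B + ln U + - ((p - 1) * ln A + ln V)) by ring.
    rewrite exp_plus, exp_Ropp, !exp_plus, !exp_ln by assumption.
    field. split; [lra |]. pose proof (exp_pos ((p - 1) * ln A)). lra. }
  rewrite HE.
  set (l := log_ratio (p - 1) x).
  set (K := Rpower A (p - 1) * V / (sin x ^ 2 * (Rpower A p + Rpower B p))).
  pose proof (Rpower_pos A p). pose proof (Rpower_pos B p).
  pose proof (Rpower_pos A (p - 1)).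
  assert (0 < sin x ^ 2) by (apply pow_lt; lra).
  assert (HK : 0 < K) by (apply Rdiv_lt_0_compat; nra).
  replace (_ / _) with (K * (exp l - 1)) by (unfold K; field; lra).
  assert (Hl : l < 0 -> exp l < 1) by (rewrite <- exp_0; apply exp_increasing).
  assert (Hr : 0 < l -> 1 < exp l) by (rewrite <- exp_0; apply exp_increasing).
  assert (Hz : l = 0 -> exp l = 1) by (intros ->; apply exp_0).
  destruct (Rtotal_order l 0) as [Hc | [Hc | Hc]];
    [specialize (Hl Hc) | specialize (Hz Hc) | specialize (Hr Hc)];
    repeat split; intros; try lra; nra.
Qed.

Lemma ln_cos_plus_sin_PI4 : ln (cos (PI / 4) + sin (PI / 4)) = ln 2 / 2.
Proof.
  assert (H : 0 < cos (PI / 4) + sin (PI / 4)).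
  { pose proof PI_RGT_0. pose proof (trig_first_quadrant (PI / 4) ltac:(lra)). lra. }
  assert (E : (cos (PI / 4) + sin (PI / 4)) * (cos (PI / 4) + sin (PI / 4)) = 2).
  { pose proof (sin2_cos2_pow (PI / 4)). pose proof cos_PI4. pose proof sin_PI4.
    assert (sin (PI / 4) = cos (PI / 4)) by congruence. nra. }
  pose proof (ln_mult _ _ H H) as L. rewrite E in L. lra.
Qed.

Lemma p0_denominator_pos : 0 < 4 + 2 * ln 2 - PI.
Proof. pose proof PI_4. pose proof ln_lt_2. lra. Qed.

Lemma p0_gt_1 : 1 < p0.
Proof.
  pose proof p0_denominator_pos. pose proof ln_lt_2. pose proof PI2_3_2.
  unfold p0. apply (Rmult_lt_reg_r (4 + 2 * ln 2 - PI)); [assumption |].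
  field_simplify; lra.
Qed.

Lemma ln2_div_p0 : ln 2 / p0 = 1 + ln 2 / 2 - PI / 4.
Proof.
  pose proof p0_denominator_pos. pose proof ln_lt_2.
  unfold p0. field. lra.
Qed.

(** Continuous minorants replace the singular terms of [log_quotient p0]: near
    [0], [x cos x / sin x >= cos x]; near [PI / 4], the power of the vanishing
    quantity [cos x - sin x] is at most [cos x - sin x], since [p0 > 1].  Both
    minorants vanish at their end point. *)
Lemma log_quotient_p0_pos (x : R) : 0 < x < PI / 4 -> 0 < log_quotient p0 x.
Proof.
  pose proof p0_gt_1 as Hp. pose proof PI_RGT_0.
  assert (Hq : sin (PI / 4) = cos (PI / 4)) by (rewrite sin_PI4, cos_PI4; reflexivity).
  pose proof (trig_first_quadrant (PI / 4) ltac:(lra)).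
  apply (positive_between_zeros (log_quotient p0) (log_quotient_derivative p0)
    (fun x => cos x - 1
       - ln ((Rpower (cos x + sin x) p0 + Rpower (cos x - sin x) p0) / 2) / p0)
    (fun x => x * cos x / sin x - 1
       - ln ((Rpower (cos x + sin x) p0 + (cos x - sin x)) / 2) / p0)).
  - intros z Hz. apply is_derive_log_quotient; lra.
  - apply derivable_continuity_pt. unfold Rpower. auto_derive.
    rewrite cos_0, sin_0.
    pose proof (exp_pos (p0 * ln (1 + 0))). pose proof (exp_pos (p0 * ln (1 + - 0))).
    lra.
  - cbv beta. rewrite cos_0, sin_0, Rminus_0_r, Rplus_0_r. unfold Rpower.
    rewrite ln_1, Rmult_0_r, exp_0. replace ((1 + 1) / 2) with 1 by field.
    rewrite ln_1. lra.
  - intros z Hz. pose proof (trig_first_quadrant z ltac:(lra)).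
    assert (cos z <= z * cos z / sin z).
    { apply (Rmult_le_reg_r (sin z)); [lra |]. field_simplify; nra. }
    unfold log_quotient. lra.
  - apply derivable_continuity_pt. unfold Rpower. auto_derive.
    pose proof (exp_pos (p0 * ln (cos (PI / 4) + sin (PI / 4)))). lra.
  - cbv beta. rewrite Hq at 1 3. unfold Rpower. rewrite ln_cos_plus_sin_PI4, Rminus_diag, Rplus_0_r.
    rewrite ln_div, ln_exp by (try apply exp_pos; lra).
    pose proof ln2_div_p0 as Hl.
    replace (PI / 4 * cos (PI / 4) / cos (PI / 4)) with (PI / 4) by (field; lra).
    replace ((p0 * (ln 2 / 2) - ln 2) / p0) with (ln 2 / 2 - ln 2 / p0)
      by (field; lra).
    lra.
  - intros z Hz. pose proof (trig_first_octant z Hz). unfold log_quotient.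
    assert (HB : Rpower (cos z - sin z) p0 <= cos z - sin z).
    { rewrite <- (Rpower_1 (cos z - sin z)) at 2 by lra.
      assert (ln (cos z - sin z) < 0) by (rewrite <- ln_1; apply ln_increasing; lra).
      apply exp_nondecreasing. nra. }
    pose proof (Rpower_pos (cos z + sin z) p0). pose proof (Rpower_pos (cos z - sin z) p0).
    apply Rplus_le_compat_l, Ropp_le_contravar.
    apply Rmult_le_compat_r; [left; apply Rinv_0_lt_compat; lra |].
    apply ln_le; lra.
  - intros y z Hyz Hz Hy.
    apply (log_quotient_derivative_sign p0 z ltac:(lra)).
    apply (log_quotient_derivative_sign p0 y ltac:(lra)) in Hy.
    apply (stays_negative_log_ratio (p0 - 1) ltac:(lra) y); assumption.
Qed.

(** Dropping the positive term [(cos x - sin x)^p] leaves a majorant of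
    [log_quotient p] that is continuous at [PI / 4], with value
    [ln 2 / p - ln 2 / p0] there. *)
Lemma log_quotient_pos_le_p0 (p : R) :
  0 < p -> (forall x, 0 < x < PI / 4 -> 0 < log_quotient p x) -> p <= p0.
Proof.
  intros Hp Hpos. pose proof PI_RGT_0. pose proof p0_gt_1.
  assert (Hq : sin (PI / 4) = cos (PI / 4)) by (rewrite sin_PI4, cos_PI4; reflexivity).
  pose proof (trig_first_quadrant (PI / 4) ltac:(lra)).
  assert (Hlim : 1 + ln (cos (PI / 4) + sin (PI / 4))
                 - PI / 4 * cos (PI / 4) / sin (PI / 4) <= ln 2 / p).
  { apply (continuous_le_from_left
      (fun x => 1 + ln (cos x + sin x) - x * cos x / sin x) 0); [lra | |].
    - apply derivable_continuity_pt. auto_derive. lra.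
    - intros z Hz. specialize (Hpos z Hz). unfold log_quotient in Hpos.
      pose proof (trig_first_octant z Hz).
      pose proof (Rpower_pos (cos z + sin z) p). pose proof (Rpower_pos (cos z - sin z) p).
      assert (Hln : ln (Rpower (cos z + sin z) p / 2)
        < ln ((Rpower (cos z + sin z) p + Rpower (cos z - sin z) p) / 2))
        by (apply ln_increasing; lra).
      apply (Rmult_lt_compat_r (/ p)) in Hln; [| now apply Rinv_0_lt_compat].
      unfold Rpower at 1 in Hln.
      rewrite ln_div, ln_exp in Hln by (try apply exp_pos; lra).
      replace ((p * ln (cos z + sin z) - ln 2) * / p)
        with (ln (cos z + sin z) - ln 2 / p) in Hln by (field; lra).
      unfold Rdiv at 2 in Hpos. lra. }
  rewrite ln_cos_plus_sin_PI4, Hq in Hlim.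
  replace (PI / 4 * cos (PI / 4) / cos (PI / 4)) with (PI / 4) in Hlim by (field; lra).
  pose proof ln2_div_p0 as Hl. pose proof ln_lt_2.
  assert (Hle : ln 2 / p0 <= ln 2 / p) by lra.
  apply (Rmult_le_compat_r (p * p0)) in Hle; [| nra].
  replace (ln 2 / p0 * (p * p0)) with (ln 2 * p) in Hle by (field; lra).
  replace (ln 2 / p * (p * p0)) with (ln 2 * p0) in Hle by (field; lra).
  nra.
Qed.

(** * Power means *)

Lemma power_mean_exp (p a b : R) :
  p <> 0 -> power_mean p a b = exp (ln ((Rpower a p + Rpower b p) / 2) / p).
Proof.
  intros Hp. unfold power_mean. destruct (Req_dec_T p 0); [contradiction |].
  unfold Rpower at 1. f_equal. field. assumption.
Qed.

Lemma power_mean_0_exp (a b : R) :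
  0 < a -> 0 < b -> power_mean 0 a b = exp ((ln a + ln b) / 2).
Proof.
  intros Ha Hb. unfold power_mean. destruct (Req_dec_T 0 0); [| contradiction].
  rewrite <- Rpower_sqrt by nra. unfold Rpower. rewrite ln_mult by assumption.
  f_equal. field.
Qed.

(** Writing [x^s = x exp ((s - 1) ln x)], apply [1 + y <= exp y] at
    [y = (s - 1) ln x] and then at [y = - ln x]. *)
Lemma bernoulli_Rpower (x s : R) : 0 < x -> 1 <= s -> 1 + s * (x - 1) <= Rpower x s.
Proof.
  intros Hx Hs. unfold Rpower. rewrite Rpower_split by assumption.
  pose proof (exp_ineq1_le ((s - 1) * ln x)) as H1.
  pose proof (exp_ineq1_le (- ln x)) as H2.
  rewrite exp_Ropp, exp_ln in H2 by assumption.
  apply (Rmult_le_compat_l x) in H2; [| lra]. rewrite Rinv_r in H2 by lra.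
  nra.
Qed.

(** Jensen's inequality for the convex function [z^s]: with [m] the mean of [x] and
    [y], Bernoulli's inequality at [x / m] and [y / m] bounds the powers by tangent
    values whose mean is exactly [m^s]. *)
Lemma ln_mean_Rpower (x y s : R) :
  0 < x -> 0 < y -> 1 <= s ->
  s * ln ((x + y) / 2) <= ln ((Rpower x s + Rpower y s) / 2).
Proof.
  intros Hx Hy Hs. set (m := (x + y) / 2). assert (Hm : 0 < m) by (unfold m; lra).
  assert (HB : forall z, 0 < z -> Rpower m s * (1 + s * (z / m - 1)) <= Rpower z s).
  { intros z Hz. replace (Rpower z s) with (Rpower m s * Rpower (z / m) s).
    - apply Rmult_le_compat_l; [left; apply Rpower_pos |].
      apply bernoulli_Rpower; [now apply Rdiv_lt_0_compat | assumption].
    - rewrite Rpower_mult_distr; [| assumption | now apply Rdiv_lt_0_compat].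
      f_equal. field. lra. }
  pose proof (HB x Hx) as H1. pose proof (HB y Hy) as H2.
  rewrite <- (ln_exp (s * ln m)). fold (Rpower m s).
  apply ln_le; [apply Rpower_pos |].
  replace (Rpower m s) with
    ((Rpower m s * (1 + s * (x / m - 1)) + Rpower m s * (1 + s * (y / m - 1))) / 2).
  - lra.
  - unfold m at 2 4. field. lra.
Qed.

Lemma ln_mean_ge_geometric (p a b : R) :
  p * ((ln a + ln b) / 2) <= ln ((Rpower a p + Rpower b p) / 2).
Proof.
  rewrite <- (ln_exp (p * ((ln a + ln b) / 2))).
  apply ln_le; [apply exp_pos |].
  unfold Rpower.
  replace (p * ((ln a + ln b) / 2)) with (p * ln a / 2 + p * ln b / 2) by field.
  replace (p * ln a) with (p * ln a / 2 + p * ln a / 2) at 2 by field.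
  replace (p * ln b) with (p * ln b / 2 + p * ln b / 2) at 2 by field.
  rewrite !exp_plus.
  pose proof (pow2_ge_0 (exp (p * ln a / 2) - exp (p * ln b / 2))). nra.
Qed.

(** Exponents of opposite sign are compared through the geometric mean.  For
    exponents of the same sign, Jensen's inequality applies to the powers with
    exponent [u] of smaller absolute value, raised to [v / u >= 1]; dividing by a
    negative exponent reverses the inequality, as it should for [p <= r < 0]. *)
Lemma power_mean_monotone (p r a b : R) :
  0 < a -> 0 < b -> p <= r -> power_mean p a b <= power_mean r a b.
Proof.
  intros Ha Hb Hpr.
  assert (Hnonneg : forall t, 0 <= t -> power_mean 0 a b <= power_mean t a b).
  { intros t [Ht | <-]; [| apply Rle_refl].
    rewrite power_mean_0_exp, power_mean_exp by lra. apply exp_nondecreasing.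
    apply (Rmult_le_reg_l t); [assumption |].
    pose proof (ln_mean_ge_geometric t a b).
    replace (t * (ln ((Rpower a t + Rpower b t) / 2) / t))
      with (ln ((Rpower a t + Rpower b t) / 2)) by (field; lra).
    lra. }
  assert (Hnonpos : forall t, t <= 0 -> power_mean t a b <= power_mean 0 a b).
  { intros t [Ht | ->]; [| apply Rle_refl].
    rewrite power_mean_0_exp, power_mean_exp by lra. apply exp_nondecreasing.
    apply (Rmult_le_reg_l (- t)); [lra |].
    pose proof (ln_mean_ge_geometric t a b).
    replace (- t * (ln ((Rpower a t + Rpower b t) / 2) / t))
      with (- ln ((Rpower a t + Rpower b t) / 2)) by (field; lra).
    lra. }
  assert (Hsame : forall u v, u <> 0 -> 1 <= v / u ->
    v / u * ln ((Rpower a u + Rpower b u) / 2) <= ln ((Rpower a v + Rpower b v) / 2)).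
  { intros u v Hu Huv.
    pose proof (ln_mean_Rpower (Rpower a u) (Rpower b u) (v / u)
      (Rpower_pos a u) (Rpower_pos b u) Huv) as H.
    rewrite !Rpower_mult in H. now replace (u * (v / u)) with v in H by (field; assumption). }
  destruct (Rlt_le_dec 0 p) as [Hp | Hp]; [| destruct (Rlt_le_dec r 0) as [Hr | Hr]].
  - rewrite !power_mean_exp by lra. apply exp_nondecreasing.
    apply (Rmult_le_reg_l r); [lra |].
    assert (H1 : 1 <= r / p) by (apply (Rmult_le_reg_r p); [| field_simplify]; lra).
    specialize (Hsame p r ltac:(lra) H1).
    replace (r * (ln ((Rpower a r + Rpower b r) / 2) / r))
      with (ln ((Rpower a r + Rpower b r) / 2)) by (field; lra).
    lra.
  - rewrite !power_mean_exp by lra. apply exp_nondecreasing.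
    apply (Rmult_le_reg_l (- p)); [lra |].
    assert (H1 : 1 <= p / r).
    { replace (p / r) with (- p / - r) by (field; lra).
      apply (Rmult_le_reg_r (- r)); [| field_simplify]; lra. }
    specialize (Hsame r p ltac:(lra) H1).
    replace (- p * (ln ((Rpower a p + Rpower b p) / 2) / p))
      with (- ln ((Rpower a p + Rpower b p) / 2)) by (field; lra).
    lra.
  - apply (Rle_trans _ (power_mean 0 a b)); auto.
Qed.

Lemma power_mean_homogeneous (p k a b : R) :
  0 < k -> 0 < a -> 0 < b ->
  power_mean p (k * a) (k * b) = k * power_mean p a b.
Proof.
  intros Hk Ha Hb. destruct (Req_dec_T p 0) as [-> | Hp].
  { rewrite !power_mean_0_exp, !ln_mult by (try apply Rmult_lt_0_compat; assumption).
    rewrite <- (exp_ln k Hk) at 3. rewrite <- exp_plus. f_equal. field. }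
  rewrite !power_mean_exp by assumption.
  rewrite <- (Rpower_mult_distr k a), <- (Rpower_mult_distr k b) by assumption.
  pose proof (Rpower_pos a p). pose proof (Rpower_pos b p). pose proof (Rpower_pos k p).
  replace ((Rpower k p * Rpower a p + Rpower k p * Rpower b p) / 2)
    with (Rpower k p * ((Rpower a p + Rpower b p) / 2)) by field.
  rewrite ln_mult by lra. unfold Rpower at 1. rewrite ln_exp.
  rewrite <- (exp_ln k Hk) at 2. rewrite <- exp_plus. f_equal. field. assumption.
Qed.

Lemma power_mean_sym (p a b : R) : power_mean p a b = power_mean p b a.
Proof.
  unfold power_mean. now rewrite (Rmult_comm a b), (Rplus_comm (Rpower a p)).
Qed.

Lemma sandor_yang_mean_sym (a b : R) : sandor_yang_mean a b = sandor_yang_mean b a.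
Proof.
  assert (HT : seiffert_mean2 a b = seiffert_mean2 b a).
  { unfold seiffert_mean2.
    rewrite (Rplus_comm a b), <- (Ropp_minus_distr b a), !Rdiv_opp_l, atan_opp.
    now rewrite <- Ropp_mult_distr_r, Rdiv_opp_r, Ropp_involutive. }
  unfold sandor_yang_mean. rewrite HT. unfold quadratic_mean, arithmetic_mean.
  now rewrite (Rplus_comm a b), (Rplus_comm (a ^ 2)).
Qed.

Lemma sandor_yang_mean_polar (k x : R) :
  0 < k -> 0 < x < PI / 4 ->
  sandor_yang_mean (k * (cos x + sin x)) (k * (cos x - sin x))
  = k * exp (x * cos x / sin x - 1).
Proof.
  intros Hk Hx. pose proof (trig_first_octant x Hx).
  unfold sandor_yang_mean, quadratic_mean, arithmetic_mean, seiffert_mean2.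
  replace ((_ ^ 2 + _ ^ 2) / 2) with (k ^ 2 * (sin x ^ 2 + cos x ^ 2)) by field.
  rewrite sin2_cos2_pow.
  replace (k ^ 2 * (1 - cos x ^ 2 + cos x ^ 2)) with (k ^ 2) by ring.
  rewrite sqrt_pow2 by lra.
  replace ((k * (cos x + sin x) - k * (cos x - sin x)) /
           (k * (cos x + sin x) + k * (cos x - sin x))) with (tan x)
    by (unfold tan; field; nra).
  rewrite atan_tan by lra. do 3 f_equal. field. nra.
Qed.

Lemma sandor_yang_gt_power_mean_polar (p k x : R) :
  p <> 0 -> 0 < k -> 0 < x < PI / 4 ->
  (sandor_yang_mean (k * (cos x + sin x)) (k * (cos x - sin x))
   > power_mean p (k * (cos x + sin x)) (k * (cos x - sin x))
   <-> 0 < log_quotient p x).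
Proof.
  intros Hp Hk Hx. pose proof (trig_first_octant x Hx).
  rewrite sandor_yang_mean_polar, power_mean_homogeneous, power_mean_exp by lra.
  unfold log_quotient. split; intros Hgt.
  - apply Rmult_lt_reg_l in Hgt; [| assumption]. apply exp_lt_inv in Hgt. lra.
  - apply Rmult_lt_compat_l; [assumption |]. apply exp_increasing. lra.
Qed.

(** The angle is the arctangent occurring in the Seiffert mean. *)
Lemma polar_form (a b : R) :
  0 < b < a ->
  exists k x, 0 < k /\ 0 < x < PI / 4 /\
    a = k * (cos x + sin x) /\ b = k * (cos x - sin x).
Proof.
  intros Hab. set (x := atan ((a - b) / (a + b))).
  assert (Hx : 0 < x < PI / 4).
  { unfold x. rewrite <- atan_0, <- atan_1. split; apply atan_increasing.
    - apply Rdiv_lt_0_compat; lra.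
    - apply (Rmult_lt_reg_r (a + b)); [| field_simplify]; lra. }
  pose proof (trig_first_octant x Hx).
  assert (Ht : sin x = cos x * ((a - b) / (a + b))).
  { rewrite <- (tan_atan ((a - b) / (a + b))). fold x. unfold tan. field. lra. }
  exists ((a + b) / (2 * cos x)), x. split; [| split; [exact Hx |]].
  - apply Rdiv_lt_0_compat; lra.
  - rewrite Ht. split; field; lra.
Qed.

Theorem theorem3p2 (p : R) :
  (forall a b : R, 0 < a -> 0 < b -> a <> b ->
     sandor_yang_mean a b > power_mean p a b)
  <-> p <= p0.
Proof.
  split.
  - intros H. destruct (Rle_lt_dec p 0) as [Hp | Hp]; [pose proof p0_gt_1; lra |].
    apply log_quotient_pos_le_p0; [assumption |]. intros x Hx.
    pose proof (trig_first_octant x Hx).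
    apply (sandor_yang_gt_power_mean_polar p 1); [lra | lra | assumption |].
    apply H; lra.
  - intros Hp.
    assert (Hlt : forall a b, 0 < b < a -> sandor_yang_mean a b > power_mean p a b).
    { intros a b Hab.
      apply (Rle_lt_trans _ (power_mean p0 a b));
        [apply power_mean_monotone; lra |].
      destruct (polar_form a b Hab) as (k & x & Hk & Hx & -> & ->).
      apply sandor_yang_gt_power_mean_polar;
        [pose proof p0_gt_1; lra | assumption | assumption |].
      now apply log_quotient_p0_pos. }
    intros a b Ha Hb Hab. destruct (Rdichotomy a b Hab).
    + rewrite sandor_yang_mean_sym, power_mean_sym. apply Hlt. lra.
    + apply Hlt. lra.
Qed.
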